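(* Let $h:\mathbb{R}\to\mathbb{R}$ be a convex function such that $t\mapsto h(|t|)$ is a (convex) $L(\cdot)$-inexactly smooth function on $\mathbb{R}$. Then $f(x)=h(\|x\|)$, $x\in\mathbb{R}^d$, is $L(\cdot)$-inexactly smooth.
   Context: $\|\cdot\|$ is the Euclidean norm. $L:[0,\infty)\to(0,\infty]$ is finite for all $\delta>0$, convex, lower semicontinuous, nonincreasing, and $-1/L(\cdot)$ is convex (with $1/\infty=0$). A convex $f:\mathbb{R}^d\to(-\infty,\infty]$ is $L(\cdot)$-inexactly smooth if for all $x,y\in\mathbb{R}^d$, all $g_x\in\partial f(x)$ (convex subdifferential) and all $\delta\ge0$: $f(y)\le f(x)+\langle g_x,y-x\rangle+\frac{L(\delta)}2\|y-x\|^2+\delta$ (nothing is imposed when $L(\delta)=\infty$). Inexact smoothness is a notion for convex functions, so $h(|\cdot|)$ being inexactly smooth includes its convexity. *)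

(* Defs.v *)
From mathcomp Require Import all_boot all_order all_algebra.
From mathcomp Require Import all_classical all_reals all_analysis.
Set Implicit Arguments.
Unset Strict Implicit.
Unset Printing Implicit Defensive.
Import Order.TTheory GRing.Theory Num.Theory.
Import numFieldNormedType.Exports.
Local Open Scope classical_set_scope.
Local Open Scope ring_scope.

(* The library's norm on 'rV[R]_d is the sup norm, so the Euclidean structure
   is introduced here. *)
Definition dotprod (R : realType) (d : nat) (u v : 'rV[R]_d) : R :=
  \sum_(i < d) u ord0 i * v ord0 i.

Definition enorm (R : realType) (d : nat) (u : 'rV[R]_d) : R :=
  Num.sqrt (dotprod u u).

(* Since 0 * +oo = 0 in \bar R, the endpoints t = 0 and t = 1 impose nothing,
   even where f is infinite. *)
Definition econvex_on (R : realType) (V : lmodType R) (D : set V)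
    (f : V -> \bar R) : Prop :=
  forall (x y : V) (t : R), D x -> D y -> 0 <= t <= 1 ->
    (f (t *: x + (1 - t) *: y)%R <= t%:E * f x + (1 - t)%:E * f y)%E.

(* A function on [0, +oo[ is represented by a total L : R -> \bar R whose values
   on negative reals are irrelevant. *)
Record inexactness_profile (R : realType) (L : R -> \bar R) : Prop := {
  profile_gt0 : forall delta : R, 0 <= delta -> (0 < L delta)%E;
  profile_fin : forall delta : R, 0 < delta -> (L delta < +oo)%E;
  profile_convex : econvex_on (V := R^o) `[0, +oo[ L;
  profile_lsc : lower_semicontinuous (L : subspace `[(0 : R), +oo[ -> \bar R);
  profile_noninc : forall a b : R, 0 <= a -> a <= b -> (L b <= L a)%E;
  (* the library inverse satisfies +oo^-1 = 0 *)
  profile_NV_convex :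
    econvex_on (V := R^o) `[0, +oo[ (fun delta => - (L delta)^-1)%E
}.

Definition subdifferential (R : realType) (d : nat) (f : 'rV[R]_d -> \bar R)
    (x : 'rV[R]_d) : set 'rV[R]_d :=
  [set g | forall y, (f x + (dotprod g (y - x))%:E <= f y)%E].

Definition inexactly_smooth (R : realType) (d : nat) (L : R -> \bar R)
    (f : 'rV[R]_d -> \bar R) : Prop :=
  [/\ forall x, f x != -oo%E,
      econvex_on setT f &
      forall (x y g : 'rV[R]_d) (delta : R),
        subdifferential f x g -> 0 <= delta -> (L delta < +oo)%E ->
        (f y <= f x + (dotprod g (y - x))%:E
                + L delta * (enorm (y - x) ^+ 2 / 2)%:E + delta%:E)%E].

(* Main.v *)
Require Import Defs.
From mathcomp Require Import all_boot all_order all_algebra.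
From mathcomp Require Import all_classical all_reals all_analysis.
From mathcomp Require Import ring lra.
Import Order.TTheory GRing.Theory Num.Theory.
Import numFieldNormedType.Exports.
Local Open Scope classical_set_scope.
Local Open Scope ring_scope.

(** Put [phi t = h |t|].  Being even and convex, [phi] is nondecreasing on
    [[0, +oo[], which makes [f] convex.  A subgradient [g] of [f] at [x]
    maximizes [<g, .>] at [x] over the sphere of radius [|x|], on which [f] is
    constant, so Cauchy-Schwarz is an equality: [x = r u] and [g = s u] for a
    common direction [u], with [r = |x|], [s = |g|], and [s] is a subgradient
    of [phi] at [r].  For fixed [|y|] the bound to prove is affine in
    [c = <u, y>], which ranges over [[-|y|, |y|]]; at the two endpoints it is
    the one-dimensional hypothesis at [-|y|] and at [|y|]. *)

Section EuclideanSpace.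
Context {R : realType} {d : nat}.
Implicit Types (u v w x y g : 'rV[R]_d) (a : R).

Lemma dotprodC u v : dotprod u v = dotprod v u.
Proof. by apply: eq_bigr => i _; rewrite mulrC. Qed.

Lemma dotprodDl u v w : dotprod (u + v) w = dotprod u w + dotprod v w.
Proof. by rewrite -big_split; apply: eq_bigr => i _; rewrite !mxE mulrDl. Qed.

Lemma dotprodZl a u v : dotprod (a *: u) v = a * dotprod u v.
Proof. by rewrite mulr_sumr; apply: eq_bigr => i _; rewrite !mxE mulrA. Qed.

Lemma dotprodDr u v w : dotprod u (v + w) = dotprod u v + dotprod u w.
Proof. by rewrite dotprodC dotprodDl !(dotprodC u). Qed.

Lemma dotprodZr a u v : dotprod u (a *: v) = a * dotprod u v.
Proof. by rewrite dotprodC dotprodZl (dotprodC u). Qed.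

Lemma dotprodNl u v : dotprod (- u) v = - dotprod u v.
Proof. by rewrite -scaleN1r dotprodZl mulN1r. Qed.

Lemma dotprodNr u v : dotprod u (- v) = - dotprod u v.
Proof. by rewrite dotprodC dotprodNl dotprodC. Qed.

Definition dotprodE :=
  (dotprodDl, dotprodDr, dotprodNl, dotprodNr, dotprodZl, dotprodZr).

Lemma dotprod_ge0 u : 0 <= dotprod u u.
Proof. by apply: sumr_ge0 => i _; rewrite -expr2 sqr_ge0. Qed.

Lemma dotprod_eq0 u : dotprod u u = 0 -> u = 0.
Proof.
move=> /eqP; rewrite psumr_eq0; last by move=> i _; rewrite -expr2 sqr_ge0.
move=> /allP u0; apply/rowP => i; rewrite mxE; apply/eqP.
by have := u0 i (mem_index_enum i); rewrite mulf_eq0 orbb.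
Qed.

Lemma enorm_ge0 u : 0 <= enorm u.
Proof. exact: sqrtr_ge0. Qed.

Lemma enorm_sqr u : enorm u ^+ 2 = dotprod u u.
Proof. by rewrite sqr_sqrtr // dotprod_ge0. Qed.

Lemma enorm0 : enorm (0 : 'rV[R]_d) = 0.
Proof. by rewrite /enorm -(scale0r 0) dotprodZl mul0r sqrtr0. Qed.

Lemma enorm_eq0 u : enorm u = 0 -> u = 0.
Proof. by move=> u0; apply: dotprod_eq0; rewrite -enorm_sqr u0 expr0n. Qed.

Lemma enormZ a u : enorm (a *: u) = `|a| * enorm u.
Proof.
by rewrite /enorm dotprodZl dotprodZr mulrA sqrtrM -expr2 ?sqr_ge0 // sqrtr_sqr.
Qed.

(** Cauchy-Schwarz: expand the square of [enorm u *: v - enorm v *: u], which is nonnegative, and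
    cancel the positive factor [enorm u * enorm v]. *)
Lemma dotprod_le u v : dotprod u v <= enorm u * enorm v.
Proof.
have [/enorm_eq0 ->|u0] := eqVneq (enorm u) 0.
  by rewrite enorm0 -(scale0r 0) dotprodZl !mul0r.
have [/enorm_eq0 ->|v0] := eqVneq (enorm v) 0.
  by rewrite enorm0 -(scale0r 0) dotprodZr mul0r mulr0.
have uv0 : 0 < enorm u * enorm v by rewrite mulr_gt0 // lt0r ?u0 ?v0 enorm_ge0.
have := dotprod_ge0 (enorm u *: v - enorm v *: u).
rewrite !dotprodE (dotprodC v u) -!enorm_sqr => H.
by rewrite -(ler_pM2l uv0); nra.
Qed.

Lemma ler_norm_dotprod u v : `|dotprod u v| <= enorm u * enorm v.
Proof.
rewrite ler_norml dotprod_le andbT lerNl -dotprodNl.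
by rewrite (le_trans (dotprod_le _ _))// -scaleN1r enormZ normrN1 mul1r.
Qed.

(** Equality case of Cauchy-Schwarz: the same square is [2 |u| |v| (|u| |v| - <u, v>)], hence at
    most 0. *)
Lemma dotprod_max_collinear u v :
  enorm u * enorm v <= dotprod u v -> enorm u *: v = enorm v *: u.
Proof.
move=> uv; apply/eqP; rewrite -subr_eq0; apply/eqP/dotprod_eq0/eqP.
rewrite eq_le dotprod_ge0 andbT !dotprodE (dotprodC v u) -!enorm_sqr.
have := mulr_ge0 (enorm_ge0 u) (enorm_ge0 v).
by nra.
Qed.

Lemma enormD u v : enorm (u + v) <= enorm u + enorm v.
Proof.
rewrite -(@ler_pXn2r _ 2) ?nnegrE ?addr_ge0 ?enorm_ge0//.
rewrite enorm_sqr !dotprodE (dotprodC v u) -!enorm_sqr.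
by have := dotprod_le u v; nra.
Qed.

Lemma radial_subgradient_collinear (h : R -> R) x g :
  subdifferential (fun z => (h (enorm z))%:E) x g ->
  exists u, [/\ x = enorm x *: u, g = enorm g *: u & u = 0 \/ enorm u = 1].
Proof.
move=> sub_g.
have [g0|g0] := eqVneq (enorm g) 0.
  have [/[dup] x0 /enorm_eq0 ->|x0] := eqVneq (enorm x) 0.
    (* The choice [u = 0] also covers [d = 0], where no unit vector exists. *)
    by exists 0; rewrite (enorm_eq0 _ g0) !scaler0; split => //; left.
  exists ((enorm x)^-1 *: x); split.
  - by rewrite scalerA mulfV // scale1r.
  - by rewrite g0 scale0r; apply: enorm_eq0.
  - by right; rewrite enormZ ger0_norm ?invr_ge0 ?enorm_ge0 // mulVf.
exists ((enorm g)^-1 *: g); split; last first.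
- by right; rewrite enormZ ger0_norm ?invr_ge0 ?enorm_ge0 // mulVf.
- by rewrite scalerA mulfV // scale1r.
(* The test point is the positive multiple of [g] of norm [enorm x]: the two values of [h] cancel,
   leaving [|g| |x| <= <g, x>]. *)
have := sub_g ((enorm x / enorm g) *: g).
rewrite enormZ ger0_norm ?divr_ge0 ?enorm_ge0 // divfK // -EFinD lee_fin.
rewrite !dotprodE -enorm_sqr.
have -> : enorm x / enorm g * enorm g ^+ 2 = enorm x * enorm g by field.
move=> xg; have /dotprod_max_collinear H : enorm g * enorm x <= dotprod g x.
  by lra.
by rewrite scalerA mulrC -scalerA -H scalerA mulVf // scale1r.
Qed.

End EuclideanSpace.

Section RadialProfile.
Context {R : realType} (h : R -> R).
Let phi := fun t : 'rV[R]_1 => (h `|t ord0 ord0|)%:E.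

Lemma even_extension_convex : econvex_on setT phi ->
  forall a b t : R, 0 <= t <= 1 ->
    h `|t * a + (1 - t) * b| <= t * h `|a| + (1 - t) * h `|b|.
Proof.
move=> phi_cvx a b t t01; have := phi_cvx (const_mx a) (const_mx b) t I I t01.
by rewrite /phi !mxE -!EFinM -EFinD lee_fin.
Qed.

(** The point [a] is a convex combination of [b] and [- b], where [phi] takes the same value
    [h b]. *)
Lemma even_convex_nondecreasing : econvex_on setT phi ->
  forall a b : R, 0 <= a -> a <= b -> h a <= h b.
Proof.
move=> /even_extension_convex phi_cvx a b a0 ab.
have [b0|b0] := eqVneq b 0.
  by have -> : a = b by lra.
have bgt0 : 0 < b by rewrite lt_neqAle eq_sym b0; lra.
have ab01 : 0 <= a / b <= 1.
  by rewrite divr_ge0 ?(ltW bgt0) //= ler_pdivrMr // mul1r.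
have /(phi_cvx b (- b)) : 0 <= (1 + a / b) / 2 <= 1 by lra.
have -> : (1 + a / b) / 2 * b + (1 - (1 + a / b) / 2) * - b = a by field.
rewrite normrN !ger0_norm ?(ltW bgt0) //.
by rewrite -mulrDl addrC subrK mul1r.
Qed.

Lemma radial_convex (d : nat) : econvex_on setT phi ->
  econvex_on setT (fun x : 'rV[R]_d => (h (enorm x))%:E).
Proof.
move=> phi_cvx x y t _ _ /[dup] t01 /andP[t0 t1].
rewrite -!EFinM -EFinD lee_fin.
have := even_extension_convex phi_cvx (enorm x) (enorm y) _ t01.
have s0 : 0 <= 1 - t by lra.
rewrite !ger0_norm ?addr_ge0 ?mulr_ge0 ?enorm_ge0 //; apply: le_trans.
apply: (even_convex_nondecreasing phi_cvx); first exact: enorm_ge0.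
by apply: le_trans (enormD _ _) _; rewrite !enormZ !ger0_norm.
Qed.

(** For a unit vector [u], this is the subgradient inequality at [g] restricted to the line spanned
    by [u]. For [u = 0], both [x] and [g] vanish, and monotonicity of [h] shows that [phi] is
    minimal at 0. *)
Lemma radial_subgradient_profile (d : nat) (x g u : 'rV[R]_d) :
  econvex_on setT phi ->
  subdifferential (fun z => (h (enorm z))%:E) x g ->
  x = enorm x *: u -> g = enorm g *: u -> u = 0 \/ enorm u = 1 ->
  subdifferential phi (const_mx (enorm x)) (const_mx (enorm g)).
Proof.
move=> phi_cvx sub_g xu gu u01 t.
rewrite /phi /dotprod big_ord1 !mxE -EFinD lee_fin (ger0_norm (enorm_ge0 x)).
case: u01 => [u0|u1].
  rewrite xu gu u0 !scaler0 enorm0 mul0r addr0.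
  by apply: (even_convex_nondecreasing phi_cvx).
have := sub_g (t ord0 ord0 *: u).
rewrite -EFinD lee_fin enormZ u1 mulr1.
suff -> : dotprod g (t ord0 ord0 *: u - x) = enorm g * (t ord0 ord0 - enorm x).
  by [].
rewrite {1}gu {1}xu !dotprodE -enorm_sqr u1.
by ring.
Qed.

End RadialProfile.

Lemma affine_le_of_endpoints (R : realFieldType) (a b c r : R) :
  `|c| <= r -> a - b * r <= 0 -> a + b * r <= 0 -> a + b * c <= 0.
Proof.
rewrite ler_norml => /andP[cl cr] Hl Hr.
have [b0|b0] := lerP 0 b; by nra.
Qed.

(* The real line is the Euclidean space 'rV[R]_1, with t identified with its
   single coordinate t ord0 ord0. *)
Theorem lemma2p7 (R : realType) (L : R -> \bar R) (h : R -> R) (d : nat) :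
  inexactness_profile L ->
  convex_function (E := R^o) setT h ->
  inexactly_smooth L (fun t : 'rV[R]_1 => (h `|t ord0 ord0|)%:E) ->
  inexactly_smooth L (fun x : 'rV[R]_d => (h (enorm x))%:E).
Proof.
move=> profL _ [_ phi_cvx phi_smooth]; split => //.
  exact: radial_convex.
move=> x y g delta sub_g delta0 Lfin.
have [u [xu gu u01]] := radial_subgradient_collinear _ _ _ sub_g.
have sub_s := radial_subgradient_profile _ _ _ _ _ phi_cvx sub_g xu gu u01.
have /fineK L_E : L delta \is a fin_num.
  by rewrite ge0_fin_numE // ltW // (profile_gt0 profL).
have smooth1 (t : R) : h `|t| <= h (enorm x) + enorm g * (t - enorm x)
    + fine (L delta) * ((t - enorm x) ^+ 2 / 2) + delta.
  have := phi_smooth _ (const_mx t) _ _ sub_s delta0 Lfin.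
  rewrite -L_E enorm_sqr /dotprod !big_ord1 !mxE (ger0_norm (enorm_ge0 x)).
  by rewrite -EFinM -!EFinD lee_fin expr2.
(* Only [enorm u <= 1] matters here, so both cases for [u] are covered. *)
have c_le : `|dotprod u y| <= enorm y.
  apply: le_trans (ler_norm_dotprod _ _) _; rewrite ler_piMl ?enorm_ge0 //.
  by case: u01 => ->; rewrite ?enorm0.
rewrite -L_E -EFinM -!EFinD lee_fin.
have gx : dotprod g x = enorm g * enorm x.
  have [u0|u1] := u01.
    by rewrite xu gu u0 !scaler0 enorm0 -(scale0r 0) dotprodZl !mul0r.
  by rewrite {1}gu {1}xu !dotprodE -enorm_sqr u1; ring.
have gy : dotprod g y = enorm g * dotprod u y by rewrite {1}gu dotprodZl.
have xy : dotprod x y = enorm x * dotprod u y by rewrite {1}xu dotprodZl.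
rewrite enorm_sqr !dotprodE (dotprodC y x) gx gy xy -!enorm_sqr.
have := smooth1 (- enorm y); have := smooth1 (enorm y).
rewrite normrN !(ger0_norm (enorm_ge0 y)).
move: (enorm x) (enorm y) (enorm g) (dotprod u y) (fine _) c_le
  => r rho s c l c_le Hp Hm.
rewrite -subr_le0.
(* Left side minus right side as an affine function of [c]: since [|y - x|^2 = rho^2 + r^2 - 2 r c],
   its slope is [l * r - s]. At [c = rho] and [c = - rho] the squared distance becomes [(rho - r)^2]
   and [(- rho - r)^2], as in [Hm] and [Hp]. *)
have := affine_le_of_endpoints _ (h rho - (h r - s * r
  + l * ((rho ^+ 2 + r ^+ 2) / 2) + delta)) (l * r - s) c rho c_le.
by move=> H; apply: le_trans (H _ _); lra.
Qed.
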